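(* Let $A$ be a finite abelian group and let $B$ be a subgroup of $A$ of index $2$. Then the number of subsets $S\subseteq A\setminus B$ such that $\mathrm{Cay}(A,S)$ is a DRR is at least $$2^{\frac{|A|}{2}}-3\cdot 2^{\frac{3|A|}{8}+(\log_2|A|)^2}.$$
   Context: For a finite group $G$ and $S\subseteq G$, the Cayley digraph $\mathrm{Cay}(G,S)$ has vertex set $G$ and an arc $(g,h)$ if and only if $gh^{-1}\in S$. The group $G$ acts regularly on it by right multiplication and is identified with this subgroup of $\mathrm{Aut}(\mathrm{Cay}(G,S))$. $\mathrm{Cay}(G,S)$ is a DRR (digraphical regular representation) if $\mathrm{Aut}(\mathrm{Cay}(G,S))=G$. When $S\subseteq A\setminus B$ with $B$ of index $2$, $\mathrm{Cay}(A,S)$ is bipartite with parts $B$ and $A\setminus B$. *)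

(* Defs.v *)
From mathcomp Require Import all_boot all_order all_fingroup all_algebra.
From mathcomp Require Import reals exp.

Set Implicit Arguments.
Unset Strict Implicit.
Unset Printing Implicit Defensive.

Import GroupScope.

Definition digraph_aut (T : finType) (e : rel T) : {set {perm T}} :=
  [set s : {perm T} | [forall x, forall y, e (s x) (s y) == e x y]].

Definition cayley (gT : finGroupType) (S : {set gT}) : rel gT :=
  fun g h => g * h^-1 \in S.

Definition right_regular (gT : finGroupType) : {set {perm gT}} :=
  actperm 'R @* [set: gT].

Definition is_DRR (gT : finGroupType) (S : {set gT}) : bool :=
  digraph_aut (cayley S) == right_regular gT.

Definition log2 (R : realType) (x : R) : R := (ln x / ln 2)%R.

(* Main.v *)
(** If [Cay(A, S)] is not a DRR, choose [G] minimal with [A < G <= Aut], so that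
[A] is maximal in [G], and let [X] be the stabiliser of [1].  If [A] is normal in
[G], a nontrivial element of [X] is an automorphism of [A] preserving [S].
Otherwise [A] meets its other conjugates in [Z = Z(G)], so [G / Z] is a Frobenius
group with complement [A / Z]; let [N / Z] be its kernel.  By coprimality [X <= N],
hence [N = Z x X], and [N] is abelian because its derived subgroup is a normal
subgroup of [G] inside the core-free [X].  For [a0] in [A \ Z] the commutators
[~ n, a0], [n] in [N], form a normal subgroup [M] of [G] meeting [Z] trivially, and
[H = Z :&: M X] is a nontrivial subgroup of [Z] such that [S \ Z] is a union of
[H]-cosets.

In both cases [S] is invariant under a nontrivial permutation of [A] whose fixed
points lie in a proper subgroup [K].  As [|K \ B| <= |A| / 4], this permutation has
at most [3 |A| / 8] orbits inside [A \ B].  An automorphism, and likewise a pair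
([h], [K]) with [h] in [K], is determined by [floor (log2 |A|)] elements of [A]. *)

Require Import Defs.
From mathcomp Require Import all_boot all_order all_fingroup all_algebra.
From mathcomp Require Import all_solvable all_character.
From mathcomp Require Import reals exp.
From mathcomp Require Import zify.

Set Implicit Arguments.
Unset Strict Implicit.
Unset Printing Implicit Defensive.

(** * Membership in a quotient group *)

Section QuotientMembership.
Local Open Scope group_scope.

Lemma mem_coset_quotient (gT : finGroupType) (H K : {group gT}) x :
  H <| K -> x \in 'N(H) -> (coset H x \in K / H) = (x \in K).
Proof.
move=> nsHK Nx; rewrite -[in RHS](quotientGK nsHK).
by rewrite morphpreE in_setI Nx in_set.
Qed.

End QuotientMembership.

(** * Groups with a non-normal abelian maximal subgroup *)

Section AbelianMaximal.
Local Open Scope group_scope.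

Variables (gT : finGroupType) (G A : {group gT}).
Hypotheses (abA : abelian A) (maxA : maximal A G) (nnA : ~~ (A <| G)).

Let sAG : A \subset G. Proof. by have /andP[] := maxgroupp maxA. Qed.

Lemma maximal_overgroup (K : {group gT}) :
  A \subset K -> K \subset G -> K :=: A \/ K :=: G.
Proof.
move=> sAK sKG; have [_ /(_ K)maxAK] := maxgroupP maxA.
have [|pKG] := eqVproper sKG; first by right.
by left; apply: maxAK.
Qed.

Lemma abelian_maximal_normaliser : 'N_G(A) = A.
Proof.
case: (@maximal_overgroup 'N_G(A)); rewrite ?subsetI ?sAG ?normG ?subsetIl //.
by move/setIidPl=> nAG; case/negP: nnA; rewrite /normal sAG nAG.
Qed.

Lemma abelian_maximal_center_sub : 'Z(G) \subset A.
Proof.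
have /eqP := abelian_maximal_normaliser; rewrite eqEsubset => /andP[sNA _].
apply: subset_trans sNA; rewrite subsetI center_sub.
by apply: subset_trans (cent_sub _); rewrite subIset // centS ?orbT.
Qed.

(* If [a ^ g] lies in [A] with [g] outside [A], then [a ^ g] is centralised by
   both [A] and [A :^ g], which generate [G]. *)
Lemma abelian_maximal_TI a g :
  a \in A -> a \notin 'Z(G) -> g \in G -> a ^ g \in A -> g \in A.
Proof.
move=> Aa nZa Gg Aag; apply: contraR nZa => nAg.
suff: a ^ g \in 'Z(G) by rewrite memJ_norm // (subsetP (normal_norm (center_normal G))).
have [||eqA|eqG] := @maximal_overgroup (A <*> (A :^ g)).
- exact: joing_subl.
- by rewrite join_subG sAG -(conjGid Gg) conjSg.
- case/negP: nAg; rewrite -abelian_maximal_normaliser inE Gg inE.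
  by rewrite -{2}eqA joing_subr.
apply/setIP; split; first by rewrite (subsetP sAG).
rewrite -eqG centY inE (subsetP abA) //= centJ memJ_conjg.
exact: (subsetP abA).
Qed.

Lemma abelian_maximal_center_proper : 'Z(G) \proper A.
Proof.
rewrite properEneq abelian_maximal_center_sub andbT.
by apply: contraNneq nnA => <-; apply: center_normal.
Qed.

(** By [abelian_maximal_TI], [A / 'Z(G)] is a Frobenius complement in [G / 'Z(G)], and [N] is the
    preimage of the Frobenius kernel. The Hall property is recorded for the coprimality argument
    placing the stabiliser inside [N]. *)
Lemma abelian_maximal_kernel :
  exists N : {group gT},
    [/\ N <| G, 'Z(G) \proper N, N :&: A = 'Z(G), N * A = G
      & Hall (G / 'Z(G)) (N / 'Z(G))].
Proof.
have sZA := abelian_maximal_center_sub; have nsZG : 'Z(G) <| G := center_normal G.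
have nZG := normal_norm nsZG; have nZA := subset_trans sAG nZG.
have nsZA : 'Z(G) <| A by apply/andP.
have frobG : [Frobenius G / 'Z(G) with complement A / 'Z(G)].
  apply/andP; split.
    apply: contraNneq nnA => eqAG.
    suff -> : A :=: G by apply: normal_refl.
    by apply: (quotient_inj _ _ eqAG).
  apply/normedTI_memJ_P; split; rewrite ?quotientS //.
    rewrite setD_eq0 quotient_sub1 //.
    by have /andP[] := abelian_maximal_center_proper.
  move=> x y /setD1P[nta /morphimP[a Na Aa defx]] /morphimP[g Ng Gg ->].
  rewrite {}defx in nta *.
  rewrite -morphJ // in_setD1 !mem_coset_quotient //; last exact: groupJ.
  have nZa: a \notin 'Z(G).
    by apply: contra nta => Za; rewrite -(coset_id Za).
  have -> /= : coset 'Z(G) (a ^ g) != 1.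
    by rewrite morphJ // conjg_eq1.
  by apply/idP/idP => [/(abelian_maximal_TI Aa nZa Gg) // | Ag]; rewrite groupJ.
have [K frobK] := Frobenius_kernel_exists frobG.
have [defG ntK _ _ _] := Frobenius_context frobK.
have [nsKG _ mulKA _ tiKA] := sdprod_context defG.
pose N := (coset 'Z(G) @*^-1 K)%G.
have dN : N / 'Z(G) = K by rewrite cosetpreK.
have sZN : 'Z(G) \subset N := sub_cosetpre _.
have nsNG : N <| G by rewrite -(quotientGK nsZG) cosetpre_normal.
have nZN := subset_trans (normal_sub nsNG) nZG.
exists N; split=> //.
- rewrite properEneq sZN andbT; apply: contraNneq ntK => eqZN.
  by rewrite -dN -eqZN trivg_quotient.
- apply/eqP; rewrite eqEsubset subsetI sZN sZA !andbT.
  apply/subsetP=> x /setIP[Nx Ax]; apply: coset_idr; first exact: (subsetP nZA).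
  by apply/set1gP; rewrite -tiKA inE mem_quotient // -dN mem_quotient.
- by rewrite -(quotientGK nsZA) -cosetpreM mulKA quotientGK.
by rewrite dN (Frobenius_ker_Hall frobK).
Qed.

(** Meant for [A] acting regularly by translations and [X] the stabiliser of the point 1: the last
    membership then says that [x] sends the point [a] to [h * a]. *)
Lemma abelian_maximal_stabiliser (X : {group gT}) :
    X \subset G -> A :&: X = 1 -> A * X = G ->
    (forall K : {group gT}, K <| G -> K \subset X -> K :=: 1) ->
  exists H : {group gT},
    [/\ H :!=: 1, H \subset 'Z(G)
      & forall a h, a \in A -> a \notin 'Z(G) -> h \in H ->
          exists2 x, x \in X & x ^ a^-1 * h^-1 \in X].
Proof.
move=> sXG tiAX mulAX coreX.
have sZA := abelian_maximal_center_sub.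
have [N [nsNG pZN tiNA mulNA hallN]] := abelian_maximal_kernel.
have [sNG nNG] := andP nsNG; have sZN := proper_sub pZN.
have cZ z g : z \in 'Z(G) -> g \in G -> commute z g.
  by move=> /centerP[_ +] Gg => /(_ g Gg).
have nsZG : 'Z(G) <| G := center_normal G; have nZG := normal_norm nsZG.
(* Both [X] and [N / 'Z(G)] complement [A], the latter modulo the centre, so their orders agree. *)
have oX : #|X| = #|N : 'Z(G)|.
  have eq1 : (#|A| * #|X| = #|G|)%N by rewrite -mulAX TI_cardMg.
  have eq2 : (#|N| * #|A| = #|G| * #|'Z(G)|)%N by rewrite mul_cardG mulNA tiNA.
  apply/eqP; rewrite -(eqn_pmul2l (cardG_gt0 'Z(G))) Lagrange //.
  rewrite -(eqn_pmul2r (cardG_gt0 A)) eq2 -eq1.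
  by rewrite mulnC mulnA mulnAC.
have tiZX: 'Z(G) :&: X = 1 by apply/trivgP; rewrite -tiAX setSI.
(* The image of [X] modulo the centre has the order of the normal Hall subgroup [N / 'Z(G)], hence
   lies in it. *)
have sXN : X \subset N.
  have nZX := subset_trans sXG nZG; have nZN := subset_trans sNG nZG.
  rewrite -(quotientSGK nZX sZN).
  rewrite (sub_normal_Hall (Hall_pi hallN)) ?quotient_normal ?quotientS //.
  rewrite /pgroup -(card_isog (quotient_isog nZX tiZX)) oX -card_quotient //.
  by apply: pnat_pi; apply: cardG_gt0.
have mulZX : 'Z(G) * X = N.
  apply/eqP; rewrite eqEcard mul_subG //= TI_cardMg // oX Lagrange //.
have defN : 'Z(G) \* X = N.
  by rewrite cprodE // centsC; apply: subset_trans (subsetIr _ _) (centS sXG).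
(* Since [N] is a central product of ['Z(G)] and [X], its derived subgroup is that of [X]; it is
   normal in [G], so [coreX] kills it. *)
have abN : abelian N.
  have := der_cprod 1 defN; rewrite (derG1P (center_abelian G)) cprod1g => dX.
  apply/derG1P; apply: coreX; last by rewrite /= -dX der_sub.
  exact: char_normal_trans (der_char 1 N) nsNG.
have cN n1 n2 : n1 \in N -> n2 \in N -> commute n1 n2.
  by move=> N1 N2; apply: (centsP abN).
(* If [[~ n, a]] is central, then [n] conjugates [a^-1] into [A], so [n] lies in [N :&: A]. *)
have kerN n a : n \in N -> a \in A -> a \notin 'Z(G) -> [~ n, a] \in 'Z(G) -> n \in 'Z(G).
  move=> Nn Aa nZa; rewrite commgEr => Zc; rewrite -tiNA inE Nn.
  apply: (@abelian_maximal_TI a^-1); rewrite ?groupV //; first exact: (subsetP sNG).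
  by rewrite -(mulgK a (_ ^ _)) groupM ?groupV // (subsetP sZA).
have RN n g : n \in N -> g \in G -> [~ n, g] \in N.
  by move=> Nn Gg; rewrite commgEl groupM ?groupV // memJ_norm // (subsetP nNG).
have RM n1 n2 g : n1 \in N -> n2 \in N -> g \in G -> [~ n1 * n2, g] = [~ n1, g] * [~ n2, g].
  move=> N1 N2 Gg; rewrite commMgJ; congr (_ * _).
  by apply/conjg_fixP/commgP; apply: cN => //; apply: RN.
have [_ [a0 Aa0 nZa0]] := properP abelian_maximal_center_proper.
have sAG' := subsetP sAG; have Ga0 := sAG' _ Aa0.
(* By [RM], commutation with [a0] is an endomorphism of the abelian group [N]; [M] is its image. *)
have gsM : group_set [set [~ n, a0] | n in N].
  apply/group_setP; split; first by apply/imsetP; exists 1; rewrite ?comm1g.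
  move=> _ _ /imsetP[n1 N1 ->] /imsetP[n2 N2 ->].
  by rewrite -RM //; apply: imset_f; rewrite groupM.
pose M := Group gsM.
have sMN : M \subset N by apply/subsetP=> _ /imsetP[n Nn ->]; apply: RN.
have nMA : A \subset 'N(M).
  apply/subsetP=> a Aa; rewrite inE; apply/subsetP=> _ /imsetP[_ /imsetP[n Nn ->] ->].
  rewrite conjRg (_ : a0 ^ a = a0).
    by apply: imset_f; rewrite memJ_norm // (subsetP nNG) ?sAG'.
  by apply/conjg_fixP/commgP; apply: (centsP abA).
have nsMG : M <| G.
  rewrite /normal (subset_trans sMN) //= -mulNA mul_subG //.
  by apply: subset_trans (cent_sub _); apply: subset_trans abN (centS sMN).
have tiMZ m : m \in M -> m \in 'Z(G) -> m = 1.
  case/imsetP=> n Nn -> Zc; have Zn := kerN _ _ Nn Aa0 nZa0 Zc.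
  by apply/eqP/commgP; apply: cZ.
(* Commutation with [a] maps [M] into itself with kernel in [M :&: 'Z(G)], which is trivial;
   injectivity on a finite set gives surjectivity. *)
have RMonto a m : a \in A -> a \notin 'Z(G) -> m \in M -> exists2 m1, m1 \in M & [~ m1, a] = m.
  move=> Aa nZa Mm; have Ga := sAG' _ Aa; pose f n := [~ n, a].
  have injf : {in M &, injective f}.
    move=> m1 m2 M1 M2 eqf; have M12 : m1 * m2^-1 \in M by rewrite groupM ?groupV.
    have [N1 N2] := (subsetP sMN _ M1, subsetP sMN _ M2).
    apply/eqP; rewrite eq_mulgV1; apply/eqP; apply: tiMZ => //.
    apply: (kerN _ a); rewrite // ?(subsetP sMN) //.
    suff -> : [~ m1 * m2^-1, a] = 1 by apply: group1.
    apply: (mulIg [~ m2, a]); rewrite -RM ?groupM ?groupV // mulgKV mul1g; exact: eqf.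
  have : f @: M == M.
    rewrite eqEcard; apply/andP; split; last by rewrite (card_in_imset injf).
    apply/subsetP=> _ /imsetP[m1 M1 ->].
    by rewrite /f commgEl groupM ?groupV // memJ_norm // (subsetP nMA).
  by move/eqP=> fM; rewrite -fM in Mm; case/imsetP: Mm => m1 M1 ->; exists m1.
have cMX : M * X = X * M.
  by apply: centC; apply: subset_trans sMN (subset_trans abN (centS sXN)).
pose H := ('Z(G) :&: (M <*> X))%G.
have joinMX : M <*> X = M * X by apply: comm_joingE.
exists H; split; first 2 last.
(* Write [h^-1 = m * y], solve [[~ m1, a^-1] = m^-1] in [M], and take for [x] the [X]-part of [m1]:
   the central part cancels and [x ^ a^-1 = x * m^-1]. *)
- move=> a h Aa nZa /groupVr Hh.
  have /setIP[Zh] := Hh; rewrite /= joinMX => /mulsgP[m y Mm Xy def_h].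
  have [|||m1 M1 defm] := RMonto a^-1 m^-1; rewrite ?groupV //.
  have := subsetP sMN _ M1; rewrite -mulZX => /mulsgP[z x Zz Xx defm1].
  exists x => //.
  suff -> : x ^ a^-1 * h^-1 = x * y by rewrite groupM.
  have -> : x = z^-1 * m1 by rewrite defm1 mulKg.
  have -> : (z^-1 * m1) ^ a^-1 = z^-1 * (m1 * [~ m1, a^-1]).
    rewrite conjMg -conjg_mulR; congr (_ * _).
    by apply/conjg_fixP/commgP; apply: cZ; rewrite groupV ?sAG'.
  by rewrite defm def_h !mulgA mulgKV.
(* If [H] were trivial, the central part of each [m] in [M] would vanish, so [M] would lie in [X]
   and be trivial; then all of [N] would commute with [a0], against [kerN]. *)
- apply/eqP=> H1; have sMX : M \subset X.
    apply/subsetP=> m Mm; have := subsetP sMN _ Mm.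
    rewrite -mulZX => /mulsgP[z x Zz Xx defm].
    suff z1 : z = 1 by rewrite defm z1 mul1g.
    apply/set1gP; rewrite -H1 inE Zz /= joinMX.
    by apply/mulsgP; exists m x^-1; rewrite ?groupV // defm mulgK.
  have M1 : M :=: 1 := coreX M nsMG sMX.
  have [_ [n Nn /negP[]]] := properP pZN.
  apply: (kerN _ a0) => //; suff /set1gP-> : [~ n, a0] \in [1 gT] by apply: group1.
  by rewrite -M1; apply: imset_f.
exact: subsetIl.
Qed.

End AbelianMaximal.

(** * From extra automorphisms of a Cayley digraph to symmetries of the connection set *)

Section CayleySymmetry.
Local Open Scope group_scope.

Variable gT : finGroupType.
Implicit Types (S : {set gT}) (a : gT).
Notation r := (actperm 'R%act : gT -> {perm gT}).

Lemma right_regularE a x : r a x = x * a.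
Proof. by rewrite actpermE. Qed.

Lemma mem_right_regular a : r a \in right_regular gT.
Proof. by apply: mem_morphim; rewrite inE. Qed.

Lemma right_regularP (s : {perm gT}) :
  reflect (exists a, s = r a) (s \in right_regular gT).
Proof.
apply: (iffP morphimP) => [[a _ _ ->] | [a ->]]; exists a => //; rewrite inE //.
Qed.

Lemma digraph_autP (T : finType) (e : rel T) (s : {perm T}) :
  reflect (forall x y, e (s x) (s y) = e x y) (s \in digraph_aut e).
Proof.
rewrite inE; apply: (iffP 'forall_forallP) => es x y; last by apply/eqP.
exact: eqP (es x y).
Qed.

Lemma digraph_aut_group_set (T : finType) (e : rel T) : group_set (digraph_aut e).
Proof.
apply/group_setP; split=> [|s t /digraph_autP es /digraph_autP et].
  by apply/digraph_autP=> x y; rewrite !perm1.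
by apply/digraph_autP=> x y; rewrite !permM et es.
Qed.

Canonical digraph_aut_group (T : finType) (e : rel T) :=
  Group (digraph_aut_group_set e).
Canonical right_regular_group := [group of right_regular gT].

Lemma right_regular_sub_aut S : right_regular gT \subset digraph_aut (cayley S).
Proof.
apply/subsetP=> _ /right_regularP[a ->]; apply/digraph_autP=> x y.
by rewrite /cayley !right_regularE invMg mulgA mulgK.
Qed.

(** The alternatives correspond to the regular group being normal or not in a minimal overgroup [G]
    of automorphisms; in the second, [K] is the group of elements whose translation is central in
    [G]. *)
Lemma nonDRR_symmetry S :
    abelian [set: gT] -> ~~ is_DRR S ->
  (exists s : {perm gT},
     [/\ s \in Aut [set: gT], s != 1 & forall a, (s a \in S) = (a \in S)])
  \/ (exists (K : {group gT}) (h : gT),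
     [/\ K \proper [set: gT], h \in K, h != 1
       & forall a, a \notin K -> (h * a \in S) = (a \in S)]).
Proof.
move=> abT.
rewrite /is_DRR eq_sym eqEproper right_regular_sub_aut /= negbK => pRaut.
pose R := [group of right_regular gT].
pose over (K : {group {perm gT}}) := (R \proper K) && (K \subset digraph_aut (cayley S)).
have overAut : over [group of digraph_aut (cayley S)] by apply/andP.
have [G /mingroupP[/andP[pRG sGaut] minG] _] := mingroup_exists overAut.
have sRG := proper_sub pRG.
have maxR : maximal R G.
  apply/maxgroupP; split=> // K pKG sRK; apply/eqP; rewrite eq_sym eqEproper sRK.
  apply: contraL (pKG) => pRK; rewrite (minG K) ?properxx ?proper_sub //.
  by rewrite /over pRK (subset_trans (proper_sub pKG)).
have abR : abelian R by apply: morphim_abelian.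
pose X := 'C_G[1 | 'P]%G.
have XP s : reflect (s \in G /\ s 1 = 1) (s \in X).
  by apply: (iffP setIP) => -[Gs]; [move/astab1P | move=> s1; split=> //; apply/astab1P].
have sXG : X \subset G := subsetIl _ _.
have tiRX : R :&: X = 1.
  apply/trivgP/subsetP=> s /setIP[/right_regularP[a ->] /XP[_]].
  by rewrite right_regularE mul1g => ->; rewrite morph1 inE.
have mulRX : R * X = G.
  apply/eqP; rewrite eqEsubset mul_subG //=; apply/subsetP=> s Gs.
  (* Chosen so that [t * s] fixes 1. *)
  pose t := r (s^-1 1).
  have Rt : t \in R by apply: mem_right_regular.
  apply/mulsgP; exists t^-1 (t * s); rewrite ?groupV ?mulKg //.
  have Gt := subsetP sRG _ Rt; apply/XP; split; first by rewrite groupM.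
  by rewrite permM right_regularE mul1g permKV.
(* A normal subgroup fixing 1 fixes every point, by conjugating with translations. *)
have coreX (K : {group {perm gT}}) : K <| G -> K \subset X -> K :=: 1.
  move=> /andP[_ nKG] sKX; apply/trivgP/subsetP=> k Kk; apply/set1gP/permP=> a.
  have Rra : r a^-1 \in R := mem_right_regular _.
  have /(subsetP sKX)/XP[_] : k ^ r a^-1 \in K.
    by rewrite memJ_norm // (subsetP nKG) // (subsetP sRG).
  rewrite conjgE -morphV ?inE // invgK !permM !right_regularE mul1g perm1.
  by move/(canRL (mulgK _)); rewrite mul1g invgK.
have autS s x y : s \in G -> (s x * (s y)^-1 \in S) = (x * y^-1 \in S).
  by move=> /(subsetP sGaut)/digraph_autP/(_ x y).
have [nsRG | nnRG] := boolP (R <| G).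
  left; have [s Xs nts] : exists2 s, s \in X & s != 1.
    apply/trivgPn; apply: contraTneq pRG => X1.
    by rewrite -mulRX X1 mulg1 properxx.
  have [Gs s1] := XP _ Xs; exists s; split=> //; last first.
    by move=> a; have := autS s a 1 Gs; rewrite s1 invg1 !mulg1.
  rewrite inE; apply/andP; split; first by apply/subsetP=> x; rewrite inE.
  apply/morphicP=> a b _ _.
  (* The conjugate is a translation because [s] normalises [R], and it sends 1 to [s c] because [s]
     fixes 1. *)
  have nR c : r (s c) = r c ^ s.
    have /right_regularP[d defd] : r c ^ s \in R.
      by rewrite memJ_norm ?mem_right_regular // (subsetP (normal_norm nsRG)).
    rewrite defd; congr (r _); have := congr1 (fun t : {perm gT} => t 1) defd.
    rewrite conjgE !permM !right_regularE mul1g => <-.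
    by rewrite -{1}s1 permK mul1g.
  have : r (s (a * b)) = r (s a * s b).
    by rewrite nR morphM ?inE // conjMg -!nR morphM ?inE.
  by move/(congr1 (fun t : {perm gT} => t 1)); rewrite !right_regularE !mul1g.
right; have [H [ntH sHZ symH]] := abelian_maximal_stabiliser abR maxR nnRG sXG tiRX mulRX coreX.
have pZR := abelian_maximal_center_proper maxR nnRG.
have [t Ht nt] : exists2 t, t \in H & t != 1 by apply/trivgPn.
have /right_regularP[h def_t] := subsetP (proper_sub pZR) _ (subsetP sHZ _ Ht).
pose K := (actperm 'R @*^-1 'Z(G))%G.
have KP a : (a \in K) = (r a \in 'Z(G)) by rewrite !inE.
exists K, h; split.
- have [_ [_ /right_regularP[a ->] nZa]] := properP pZR.
  by apply/properP; split; [apply: subsetT | exists a; [exact: in_setT | rewrite KP]].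
- by rewrite KP -def_t (subsetP sHZ).
- by apply: contraNneq nt => h1; rewrite def_t h1 morph1.
move=> a; rewrite KP => nZa.
have [x Xx] := symH _ _ (mem_right_regular a) nZa Ht.
have [Gx x1] := XP _ Xx; case/XP=> _.
rewrite conjgE def_t invgK -!morphV ?inE // !permM !right_regularE mul1g => xa.
have <- : x a = h * a by apply: (mulIg a^-1); apply: (mulIg h^-1); rewrite xa mulgK mulgV.
by have := autS x a 1 Gx; rewrite x1 invg1 !mulg1.
Qed.

End CayleySymmetry.

(** * Counting invariant subsets, generators and automorphisms *)

Section Counting.
Local Open Scope group_scope.

Lemma leq_card_bigcup (T I : finType) (P : pred I) (F : I -> {set T}) b :
  (forall i, P i -> #|F i| <= b) -> #|\bigcup_(i | P i) F i| <= #|P| * b.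
Proof.
move=> leFb; rewrite -sum_nat_const.
apply: (big_ind2 (fun (U : {set T}) k => #|U| <= k)) => //; first by rewrite cards0.
by move=> U1 k1 U2 k2 le1 le2; rewrite (leq_trans (leq_card_setU _ _)) ?leq_add.
Qed.

(** An invariant subset is a union of orbits contained in [Y]. Counting fixed points twice gives
    each such orbit weight at least 2, so there are at most [k] of them; the strict bound by
    [k.+1.*2] accommodates rounding down. *)
Lemma card_invariant_subsets (T : finType) (s : {perm T}) (Y : {set T}) k :
    #|Y| + #|[set y in Y | s y == y]| < k.+1.*2 ->
  #|[set S : {set T} | (S \subset Y) && [forall x, (s x \in S) == (x \in S)]]| <= 2 ^ k.
Proof.
move=> leYk; pose Q := [set O in porbits s | O \subset Y].
have leQk : #|Q| <= k.
  rewrite -ltnS -ltn_double; apply: leq_ltn_trans leYk; rewrite -muln2.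
  have trivQ : trivIset Q.
    apply/trivIsetP=> O1 O2; rewrite !inE => /andP[/imsetP[x _ ->] _] /andP[/imsetP[y _ ->] _].
    apply: contraR => /pred0Pn[z /andP[/= zx zy]].
    rewrite eq_porbit_mem; move: zx zy; rewrite -!eq_porbit_mem => /eqP<- /eqP<-.
    exact: eqxx.
  have sQY : cover Q \subset Y by apply/bigcupsP=> O; rewrite inE => /andP[].
  pose Q1 := [set O in Q | #|O| == 1%N].
  have leQ1 : #|Q1| <= #|[set y in Y | s y == y]|.
    apply: leq_trans (leq_imset_card (porbit s) _); apply: subset_leq_card.
    apply/subsetP=> O; rewrite !inE => /andP[/andP[/imsetP[x _ ->] sOY] /cards1P[y def_y]].
    have [xy syx] : x = y /\ s x = y.
      have := porbit_id s x; have := mem_porbit s 1 x; rewrite def_y expg1.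
      by move=> /set1P-> /set1P->.
    apply: imset_f; rewrite inE syx xy eqxx andbT (subsetP sOY) // -xy.
    exact: porbit_id.
  apply: leq_trans (leq_add (subset_leq_card sQY) leQ1).
  rewrite -(eqP trivQ) -sum_nat_const -sum1_card big_mkcond /=.
  rewrite [X in _ <= _ + X]big_mkcond [X in _ <= X + _]big_mkcond -big_split /=.
  apply: leq_sum => O _; rewrite [O \in Q1]inE; case QO: (O \in Q) => //=.
  move: QO; rewrite inE => /andP[/imsetP[x _ ->] _].
  have := card_porbit_neq0 s x; case: #|_| => [|[|c]] //.
rewrite (leq_trans _ (leq_pexp2l _ leQk)) // -card_powerset.
apply: leq_trans (leq_imset_card cover _); apply: subset_leq_card.
apply/subsetP=> S; rewrite inE => /andP[sSY /forallP invS].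
apply/imsetP; exists [set O in Q | O \subset S].
  by rewrite inE; apply/subsetP=> O; rewrite inE => /andP[].
apply/setP=> x; apply/idP/bigcupP=> [Sx | [O]]; last first.
  by rewrite inE => /andP[_ sOS] /(subsetP sOS).
have sxS : porbit s x \subset S.
  apply/subsetP=> _ /porbitP[i ->]; elim: i => [|i IHi]; first by rewrite perm1.
  by rewrite expgSr permM (eqP (invS _)).
exists (porbit s x); rewrite ?porbit_id // !inE sxS (subset_trans sxS) // andbT.
by rewrite andbT; apply: imset_f.
Qed.

(** Either [K] lies in [B], or [K * B = G] and exactly half of [K], itself at most half of [G], lies
    outside [B]. *)
Lemma index2_card_setD (gT : finGroupType) (G B K : {group gT}) :
    B \subset G -> #|G : B| = 2 -> K \proper G -> 4 * #|K :\: B| <= #|G|.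
Proof.
move=> sBG iBG pKG; have sKG := proper_sub pKG.
have le2K : 2 * #|K| <= #|G|.
  by rewrite -(Lagrange sKG) mulnC leq_mul // indexg_gt1; case/andP: pKG.
have oG := Lagrange sBG; rewrite iBG in oG.
have maxB : maximal B G by apply: p_index_maximal; rewrite ?iBG.
have [|eqB|eqG] := maximal_overgroup maxB (joing_subr K B).
- by rewrite join_subG sKG sBG.
- suff -> : K :\: B = set0 by rewrite cards0.
  by apply/eqP; rewrite setD_eq0 -eqB joing_subl.
have nBK : K \subset 'N(B).
  by apply: subset_trans sKG (normal_norm (index2_normal sBG iBG)).
have := mul_cardG K B; rewrite -(norm_joinEl nBK) eqG -oG.
have := cardsID B K; have := cardG_gt0 B.
move: #|K :\: B| #|K :&: B| #|K| #|B| oG le2K => d i k b.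
nia.
Qed.

(** Passing to a maximal subgroup at least halves the order, and one element outside it restores
    [G]. *)
Lemma generating_tuple (gT : finGroupType) m (G : {group gT}) :
  #|G| < 2 ^ m.+1 -> exists t : m.-tuple gT, G :=: <<[set x in t]>>.
Proof.
elim: m G => [|m IHm] G ltG.
  exists [tuple]; have -> : [set x in [tuple of [::]]] = set0 :> {set gT}.
    by apply/setP=> x; rewrite !inE.
  rewrite gen0; apply/eqP; rewrite trivg_card_le1; lia.
have [G1 | ntG] := eqVneq (G : {set gT}) 1.
  (* The length is fixed, so the tuple is padded with 1. *)
  exists (nseq_tuple _ 1); rewrite G1; apply/esym/trivgP; rewrite gen_subG.
  apply/subsetP=> x; rewrite inE => xt.
  by have /nseqP[-> _] : x \in nseq m.+1 1 := xt; apply: set11.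
have [M maxM _] : {M : {group gT} | maximal M G & [1 gT] \subset M}.
  by apply: maxgroup_exists; rewrite proper1G.
have pMG := maxgroupp maxM; have [sMG [x Gx nMx]] := properP pMG.
have [|t defM] := IHm M.
  have : 2 * #|M| <= #|G|.
    by rewrite -(Lagrange sMG) mulnC leq_mul // indexg_gt1; case/andP: pMG.
  move: ltG; rewrite (expnS _ m.+1); lia.
exists [tuple of x :: t].
have -> : [set y in [tuple of x :: t]] = x |: [set y in t].
  by apply/setP=> y; rewrite !inE.
have sxtG : <<x |: [set y in t]>> \subset G.
  by rewrite gen_subG subUset sub1set Gx (subset_trans (subset_gen _)) // -defM.
have [|eqM|->//] := @maximal_overgroup _ _ _ maxM <<x |: [set y in t]>> _ sxtG.
  by rewrite /= defM genS ?subsetUr.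
by case/negP: nMx; rewrite -eqM mem_gen ?setU11.
Qed.

Variable gT : finGroupType.

Lemma Aut_eqset_group (s t : {perm gT}) :
    s \in Aut [set: gT] -> t \in Aut [set: gT] -> group_set [set x | s x == t x].
Proof.
move=> As At; apply/group_setP; split.
  by rewrite inE -(autmE As) -(autmE At) !morph1.
move=> x y; rewrite !inE => /eqP eqx /eqP eqy.
have [/morphicP ms /morphicP mt] := (Aut_morphic As, Aut_morphic At).
by rewrite ms ?mt ?inE // eqx eqy.
Qed.

(** An automorphism is determined by its values on a generating [m]-tuple, as two automorphisms
    agree on a subgroup. *)
Lemma card_Aut_le m : #|[set: gT]| < 2 ^ m.+1 -> #|Aut [set: gT]| <= #|gT| ^ m.
Proof.
case/generating_tuple=> t def_t.
rewrite -card_tuple -(@card_in_imset _ _ (fun s : {perm gT} => [tuple of map s t]));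
  first exact: max_card.
move=> s1 s2 As1 As2 /(congr1 val)/= /eq_in_map eqs; apply/permP=> x.
have : x \in Group (Aut_eqset_group As1 As2).
  rewrite (subsetP _ x (in_setT x)) // def_t gen_subG; apply/subsetP=> y.
  by rewrite !inE => /eqs->.
by rewrite inE => /eqP.
Qed.

End Counting.

(** * Bounding the number of connection sets that give no DRR *)

Section NonDRR.
Local Open Scope group_scope.

Variables (gT : finGroupType) (B : {group gT}).
Hypotheses (abT : abelian [set: gT]) (indexB : #|[set: gT] : B| = 2).

(** Outside [B] there are half of all elements, and at most a quarter of all elements are fixed
    points there; half of the sum 1/2 + 1/4 gives the fraction 3/8. *)
Lemma card_invariant_outside (K : {group gT}) (s : {perm gT}) :
    K \proper [set: gT] -> (forall x, s x = x -> x \in K) ->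
  #|[set S : {set gT} | (S \subset [set: gT] :\: B) &&
      [forall x, (s x \in S) == (x \in S)]]| <= 2 ^ (3 * #|gT| %/ 8).
Proof.
move=> pK fixK; apply: card_invariant_subsets.
have le4 := index2_card_setD (subsetT B) indexB pK.
have oT := Lagrange (subsetT B); rewrite indexB in oT.
have leF : #|[set y in [set: gT] :\: B | s y == y]| <= #|K :\: B|.
  apply: subset_leq_card; apply/subsetP=> y; rewrite !inE andbT => /andP[-> /eqP/fixK->].
  by [].
have oY := cardsID B [set: gT]; rewrite setTI in oY.
move: le4 leF oT oY; rewrite !cardsT.
move: #|_ :\: B| #|K :\: B| #|[set _ in _ | _]| #|B| => y k f b.
have := ltn_ceil (3 * #|gT|) (isT : 0 < 8).
set q := divn _ _; move: q #|gT| => q n; rewrite -muln2; lia.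
Qed.

Lemma card_Aut_invariant (s : {perm gT}) :
    s \in Aut [set: gT] -> s != 1 ->
  #|[set S : {set gT} | (S \subset [set: gT] :\: B) &&
      [forall x, (s x \in S) == (x \in S)]]| <= 2 ^ (3 * #|gT| %/ 8).
Proof.
move=> As nts; pose K := Group (Aut_eqset_group As (group1 _)).
apply: (@card_invariant_outside K) => [|x sx]; last by rewrite inE perm1 sx.
rewrite properT; apply: contra nts => /eqP KT; apply/eqP/permP=> x.
by apply/eqP; have := in_setT x; rewrite -KT inE.
Qed.

Lemma card_translation_invariant (K : {group gT}) h :
    K \proper [set: gT] -> h \in K -> h != 1 ->
  #|[set S : {set gT} | (S \subset [set: gT] :\: B) &&
      [forall (a | a \notin K), (h * a \in S) == (a \in S)]]| <= 2 ^ (3 * #|gT| %/ 8).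
Proof.
(* As [h] lies in [K], translation by [h] preserves the complement of [K], so it can be extended by
   the identity on [K] to a permutation. *)
move=> pK Kh nth; pose f a := if a \in K then a else h * a.
have fK a : (f a \in K) = (a \in K) by rewrite /f; case: ifP => [-> // | <-]; rewrite groupMl.
have injf : injective f.
  move=> a b eqf; have := fK a; rewrite eqf fK => eqK; move: eqf.
  by rewrite /f eqK; case: ifP => _ => [// | /mulgI].
apply: leq_trans (@card_invariant_outside K (perm injf) pK _); last first.
  move=> x; rewrite permE /f; case: ifP => // _ /eqP.
  by rewrite -{2}(mul1g x) (inj_eq (mulIg x)) (negPf nth).
apply: subset_leq_card; apply/subsetP=> S; rewrite !inE => /andP[-> /forall_inP inv].
apply/forallP=> x; rewrite permE /f; case: ifPn => // nKx.
exact: inv.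
Qed.

Lemma card_nonDRR :
  #|[set S : {set gT} | (S \subset [set: gT] :\: B) && ~~ is_DRR S]|
    <= 2 * #|gT| ^ trunc_log 2 #|gT| * 2 ^ (3 * #|gT| %/ 8).
Proof.
set n := #|gT|; set m := trunc_log 2 n; set b := (2 ^ _)%N.
have oT : #|[set: gT]| = n by rewrite cardsT.
have n_gt1 : 1 < n.
  by have := Lagrange (subsetT B); have := cardG_gt0 B; rewrite oT indexB; lia.
have ltnm : n < 2 ^ m.+1 by apply: trunc_log_ltn.
have m_gt0 : 0 < m by rewrite trunc_log_gt0.
(* A proper subgroup has order at most [n / 2], so [m.-1] generators suffice; together with [h] this
   makes at most [n ^ m] pairs, the same bound as for automorphisms. *)
pose P2 := [pred p : gT * m.-1.-tuple gT |
  [&& p.1 != 1, p.1 \in <<[set x in p.2]>> & <<[set x in p.2]>> \proper [set: gT]]].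
pose P1 := [pred s : {perm gT} | (s \in Aut [set: gT]) && (s != 1)].
pose F1 (s : {perm gT}) := [set S : {set gT} | (S \subset [set: gT] :\: B) &&
      [forall x, (s x \in S) == (x \in S)]].
pose F2 (p : gT * m.-1.-tuple gT) := [set S : {set gT} | (S \subset [set: gT] :\: B) &&
      [forall (a | a \notin <<[set x in p.2]>>), (p.1 * a \in S) == (a \in S)]].
have leP1 : #|P1| <= n ^ m.
  apply: leq_trans (card_Aut_le (m := m) _); last by rewrite oT.
  by apply: subset_leq_card; apply/subsetP=> s /andP[].
have leP2 : #|P2| <= n ^ m.
  apply: leq_trans (max_card _) _.
  by rewrite card_prod card_tuple -expnS prednK.
have leF1 : #|\bigcup_(s | P1 s) F1 s| <= #|P1| * b.
  by apply: leq_card_bigcup => s /andP[]; apply: card_Aut_invariant.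
have leF2 : #|\bigcup_(p | P2 p) F2 p| <= #|P2| * b.
  by apply: leq_card_bigcup => p /and3P[nt Kh pK]; apply: card_translation_invariant.
suff sub : [set S : {set gT} | (S \subset [set: gT] :\: B) && ~~ is_DRR S]
    \subset (\bigcup_(s | P1 s) F1 s) :|: (\bigcup_(p | P2 p) F2 p).
  apply: leq_trans (subset_leq_card sub) _.
  apply: leq_trans (leq_card_setU _ _) _.
  rewrite mul2n -addnn mulnDl; apply: leq_add.
    by apply: leq_trans leF1 _; rewrite leq_mul2r leP1 orbT.
  by apply: leq_trans leF2 _; rewrite leq_mul2r leP2 orbT.
apply/subsetP=> S; rewrite inE => /andP[sSY nDRR]; rewrite inE.
have [[s [As nts inv]] | [K [h [pK Kh nth inv]]]] := nonDRR_symmetry abT nDRR.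
  apply/orP; left; apply/bigcupP; exists s; first by rewrite inE As.
  by rewrite inE sSY; apply/forallP=> x; rewrite inv.
have [|t defK] := @generating_tuple _ m.-1 K.
  have : 2 * #|K| <= #|[set: gT]|.
    rewrite -(Lagrange (proper_sub pK)) mulnC leq_mul // indexg_gt1.
    by case/andP: pK.
  by rewrite prednK // oT; move: ltnm; rewrite expnS; lia.
apply/orP; right; apply/bigcupP; exists (h, t); rewrite ?inE /= -defK ?nth ?Kh ?pK //.
by rewrite sSY; apply/forall_inP=> a nKa; rewrite inv.
Qed.

End NonDRR.

(** * Passage to real exponents and the final estimate *)

Import Order.TTheory GRing.Theory Num.Theory.
Local Open Scope ring_scope.

(** Write [n] as 2 to the power [log2 n] and bound the truncated logarithm by [log2 n]. *)
Lemma ler_powR_trunc_log (R : realType) (n : nat) : (0 < n)%N ->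
  ((n ^ trunc_log 2 n)%N%:R : R) <= 2 `^ (log2 n%:R ^+ 2).
Proof.
move=> n_gt0; set m := trunc_log 2 n.
have ln2_gt0 : 0 < ln 2 :> R by rewrite ln_gt0 // ltr1n.
have nE : n%:R = 2 `^ log2 n%:R :> R.
  rewrite /powR pnatr_eq0 /= /log2 divfK ?gt_eqF //.
  by rewrite lnK // posrE ltr0n.
have lemL : m%:R <= log2 (n%:R : R).
  rewrite /log2 ler_pdivlMr // mulr_natl -lnXn // ler_ln ?posrE ?exprn_gt0 ?ltr0n //.
  by rewrite -natrX ler_nat trunc_logP.
rewrite natrX nE -powR_mulrn ?powR_ge0 // -powRrM -nE.
rewrite ler_powR ?ler1n // expr2 ler_wpM2l //.
exact: le_trans lemL.
Qed.

Theorem theorem1p1 (R : realType) (A : finGroupType) (B : {group A})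
    (abA : abelian [set: A]) (indexB : #|[set: A] : B|%g = 2%N) :
  let n : R := #|A|%:R in
  2 `^ (n / 2) - 3 * 2 `^ (3 * n / 8 + log2 n ^+ 2)
    <= #|[set S : {set A} | (S \subset [set: A] :\: B) && is_DRR S]|%:R.
Proof.
lazy zeta; set n : R := #|A|%:R; set good := #|[set S | _]|.
have oT := Lagrange (subsetT B); rewrite indexB cardsT in oT.
have := card_nonDRR abA indexB.
set bad := #|[set S | _]| => le_bad.
have total : (good + bad = 2 ^ #|B|)%N.
  have -> : #|B| = #|[set: A] :\: B|.
    have := cardsID B [set: A]; rewrite setTI cardsT.
    by move: #|_ :\: B| #|B| oT => y b; lia.
  rewrite -card_powerset -(cardsID [set S | is_DRR S] (powerset _)).
  by congr (_ + _)%N; apply: eq_card => S; rewrite !inE // andbC.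
have -> : n / 2 = #|B|%:R by rewrite /n -oT natrM mulfK // pnatr_eq0.
rewrite powR_mulrn // -natrX -total natrD.
(* The two families of symmetries give the constant 2, which is then relaxed to 3. *)
rewrite lerBlDr lerD2l; apply: le_trans (_ : 2 * 2 `^ (3 * n / 8 + log2 n ^+ 2) <= _).
  rewrite powRD ?pnatr_eq0 ?implybT // [_ * 2 `^ (log2 _ ^+ 2)]mulrC.
  apply: le_trans (_ : (2 * #|A| ^ trunc_log 2 #|A| * 2 ^ (3 * #|A| %/ 8))%N%:R <= _).
    by rewrite ler_nat.
  rewrite !natrM -mulrA ler_wpM2l // ler_pM //.
    by apply: ler_powR_trunc_log; apply/card_gt0P; exists 1%g.
  rewrite natrX -powR_mulrn // ler_powR ?ler1n // ler_pdivlMr // /n -!natrM ler_nat.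
  exact: leq_divM.
by rewrite ler_wpM2r ?powR_ge0 // ler_nat.
Qed.
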